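(* Let $G=(R\cup C,E)$ be a bipartite graph with $|R|=m$ and $|C|=n$. Then the following are both lower bounds for the generic completion rank of $G$: (1) the smallest nonnegative integer $k$ such that $k(m+n)-k^2\ge |E|$; (2) the largest integer $r$ such that $G$ has the complete bipartite graph $K_{r,r}$ as a subgraph.
   Context: A bipartite graph $G=(R\cup C,E)$ is finite, with parts $R$ and $C$ and edge set $E\subseteq R\times C$. A $G$-partial matrix over $\mathbb{C}$ is a vector $M=(M_{ij})_{(i,j)\in E}\in \mathbb{C}^E$. A completion of $M$ is an $m\times n$ complex matrix $A$, rows indexed by $R$ and columns indexed by $C$, with $A_{ij}=M_{ij}$ for all $(i,j)\in E$. The complex completion rank of $M$ is the smallest rank of a completion of $M$. The generic completion rank of $G$ is the unique integer $r$ such that all $M$ in some nonempty Zariski-open subset of $\mathbb{C}^E$ have complex completion rank $r$. $K_{r,r}$ denotes the complete bipartite graph with both parts of size $r$ (for $r=0$, the empty graph). *)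

(* Defs.v *)
From mathcomp Require Import all_boot all_order all_algebra.
From mathcomp Require Import boolp classical_sets reals.
From mathcomp Require Import complex mpoly.

Set Implicit Arguments.
Unset Strict Implicit.
Unset Printing Implicit Defensive.

Local Open Scope ring_scope.
Local Open Scope classical_set_scope.

Definition smallest_nat (P : nat -> Prop) (k : nat) : Prop :=
  P k /\ forall l, P l -> (k <= l)%N.

Definition largest_nat (P : nat -> Prop) (k : nat) : Prop :=
  P k /\ forall l, P l -> (l <= k)%N.

(* The coordinates of K^I are ordered by [enum_val] in order to use {mpoly}. *)
Definition zariski_open (K : fieldType) (I : finType)
    (U : set {ffun I -> K}) : Prop :=
  exists S : set {mpoly K[#|I|]},
    U = [set x | exists2 p, S p & p.@[fun i => x (enum_val i)] != 0].

(* A bipartite graph with parts 'I_m and 'I_n is given by its edge set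
   E : {set 'I_m * 'I_n}. *)
Notation edge E := {e | e \in E}.

Section CompletionRank.
Variables (K : fieldType) (m n : nat) (E : {set 'I_m * 'I_n}).

Definition partial_matrix := {ffun edge E -> K}.

Definition completion (M : partial_matrix) (A : 'M[K]_(m, n)) : Prop :=
  forall e : edge E, A (val e).1 (val e).2 = M e.

Lemma completion_rank_ex (M : partial_matrix) :
  exists r, `[< exists2 A, completion M A & \rank A = r >].
Proof.
pose A : 'M[K]_(m, n) :=
  \matrix_(i, j) (if insub (i, j) is Some e then M e else 0).
exists (\rank A); apply/asboolP; exists A => // e.
by rewrite mxE -surjective_pairing valK.
Qed.

Definition completion_rank (M : partial_matrix) : nat :=
  ex_minn (completion_rank_ex M).

Definition is_generic_completion_rank (r : nat) : Prop :=
  exists U : set partial_matrix,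
    [/\ zariski_open U, U !=set0 & forall M, U M -> completion_rank M = r].

(* Definite description: the default value 0 is used only if no r satisfies
   the predicate, which does not happen over an algebraically closed field. *)
Definition generic_completion_rank : nat :=
  xget 0%N [set r | is_generic_completion_rank r].

End CompletionRank.

Definition has_complete_bipartite (m n : nat) (E : {set 'I_m * 'I_n})
    (r : nat) : Prop :=
  exists (A : {set 'I_m}) (B : {set 'I_n}),
    [/\ #|A| = r, #|B| = r & finset.setX A B \subset E].

(* Main.v *)
Require Import Defs.
From mathcomp Require Import all_boot all_order all_algebra.
From mathcomp Require Import boolp classical_sets reals.
From mathcomp Require Import complex mpoly.
From mathcomp Require Import closed_field.

Set Implicit Arguments.
Unset Strict Implicit.
Unset Printing Implicit Defensive.

Import GRing.Theory.
Local Open Scope ring_scope.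

(** Both bounds are read off a single partial matrix once it is known that the
completion rank is constant on a nonempty Zariski-open set.  That existence
statement is needed for an arbitrary graph, since the generic completion rank
is obtained by definite description; it holds over any algebraically closed
field.

The matrices of rank r are covered by finitely many polynomial charts, one for
each injective choice f of r rows that span the row space: such a matrix is
B *m Y, where the r rows of Y are the chosen rows and the rows of B indexed by f
form the identity.  The free parameters are the other (m - r) r entries of B
and the r n entries of Y, which makes r (m + n) - r ^ 2 of them, the dimension
of the determinantal variety.  Reading off the entries at the edges of the graph
turns each chart into a polynomial map, and a partial matrix has completion
rank at most r exactly when it lies in the image of a chart for some s <= r
([completion_rank_chart], [chart_completion_rank]).

Existence of the generic rank.  The image of a polynomial map is defined by a
first-order formula, which quantifier elimination makes equivalent to a Boolean
combination of polynomial equations.  On the locus where none of the nonzero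
polynomials of that combination vanishes its truth value is constant, so
every such image either contains a nonempty open set or misses one
([poly_image_generic]).  Intersecting these open sets over the finitely many
charts gives one on which the completion rank is constant
([generic_completion_rank_exists]).

Bound (1).  If a chart has fewer parameters than there are edges, its
components are algebraically dependent: there are more monomials of bounded
exponents in them than monomials of the corresponding degree in the
parameters ([alg_dependent]).  Its image then lies in a hypersurface.  So the
generic rank r satisfies |E| <= r (m + n) - r ^ 2.

Bound (2).  A copy of K_(r,r) in the graph specifies all entries of an r x r
submatrix, whose determinant is a nonzero polynomial in the entries of the
partial matrix; where it does not vanish every completion has rank at least
r. *)

(** * Nonvanishing of polynomials *)

Lemma base_expansion_inj (b n : nat) (f g : 'I_n -> nat) :
    (forall i, f i < b)%N -> (forall i, g i < b)%N ->
    (\sum_(i < n) f i * b ^ i)%N = (\sum_(i < n) g i * b ^ i)%N ->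
  f =1 g.
Proof.
elim: n f g => [|n IHn] f g f_lt g_lt; first by move=> _ [].
have shift (u : 'I_n.+1 -> nat) : (\sum_(i < n.+1) u i * b ^ i =
    (\sum_(i < n) u (lift ord0 i) * b ^ i) * b + u ord0)%N.
  rewrite big_ord_recl expn0 muln1 addnC big_distrl /=; congr (_ + _)%N.
  by apply: eq_bigr => i _; rewrite /bump add1n expnSr mulnA.
have b_gt0 : (0 < b)%N := leq_ltn_trans (leq0n _) (f_lt ord0).
rewrite !shift => fg.
have fg0 : f ord0 = g ord0.
  by move/(congr1 (modn^~ b)): fg; rewrite !modnMDl !modn_small.
move/(congr1 (divn^~ b)): fg; rewrite !divnMDl // !divn_small // !addn0.
move=> /(IHn _ _ (fun i => f_lt _) (fun i => g_lt _)) fgS i.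
by case: (unliftP ord0 i) => [j|] ->.
Qed.

Section Nonvanishing.
Variable K : closedFieldType.

(** Kronecker substitution: with b larger than every exponent of p, setting the
i-th variable to t ^ (b ^ i) sends distinct monomials to distinct powers of t,
so p becomes a nonzero univariate polynomial, and over an algebraically closed
field such a polynomial has a non-root. *)
Lemma mpoly_nonvanishing n (p : {mpoly K[n]}) :
  p != 0 -> exists x : 'I_n -> K, p.@[x] != 0.
Proof.
move=> p_neq0; pose b := msize p.
pose code (m : 'X_{1..n}) := (\sum_(i < n) m i * b ^ i)%N.
pose q : {poly K} := \sum_(m <- msupp p) p@_m *: 'X^(code m).
have qE t : q.[t] = p.@[fun i => t ^+ (b ^ i)].
  rewrite mevalE horner_sum; apply: eq_bigr => m _.
  rewrite hornerZ hornerXn -prodrXr; congr (_ * _); apply: eq_bigr => i _.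
  by rewrite -exprM mulnC.
have lt_b m i : m \in msupp p -> (m i < b)%N.
  move=> /msize_mdeg_lt; apply: leq_ltn_trans.
  by rewrite mdegE (bigD1 i) //= leq_addr.
have q_neq0 : q != 0.
  apply: contraNneq p_neq0 => q_eq0; rewrite -mleadc_eq0.
  have /eqP := congr1 (fun r : {poly K} => r`_(code (mlead p))) q_eq0.
  rewrite coef0 coef_sum.
  have [lead_p|/memN_msupp_eq0 ->//] := boolP (mlead p \in msupp p).
  rewrite (bigD1_seq _ lead_p) ?msupp_uniq //= coefZ coefXn eqxx mulr1.
  rewrite big1_seq ?addr0 // => m.
  case/andP=> neq_m m_p; rewrite coefZ coefXn; case: eqP => [|_]; last first.
    by rewrite mulr0.
  move=> /base_expansion_inj eq_m; case/eqP: neq_m; apply/mnmP => i.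
  by rewrite (eq_m _ _ i) // => j; apply: lt_b.
have [t] := closed_nonrootP _ q_neq0; rewrite rootE qE => pt.
by eexists; exact: pt.
Qed.

End Nonvanishing.

(** * Algebraic dependence *)

Lemma msize_prod_le (R : idomainType) N (I : finType) (F : I -> {mpoly R[N]}) D :
  (forall i, msize (F i) <= D.+1)%N ->
  (msize (\prod_i F i) <= (#|I| * D).+1)%N.
Proof.
move=> F_le; rewrite cardT enumT [index_enum I]unlock.
elim: (Finite.enum I) => [|i s IHs].
  by rewrite big_nil msize1.
rewrite big_cons; set q := \prod_(j <- s) F j in IHs *.
have [->|Fi_neq0] := eqVneq (F i) 0; first by rewrite mul0r msize0.
have [->|q_neq0] := eqVneq q 0; first by rewrite mulr0 msize0.
rewrite msizeM // -subn1 leq_subLR add1n.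
by have := leq_add (F_le i) IHs; rewrite addSn addnS.
Qed.

Lemma msize_exp_le (R : idomainType) N (p : {mpoly R[N]}) k D :
  (msize p <= D.+1)%N -> (msize (p ^+ k) <= (k * D).+1)%N.
Proof.
move=> p_le; rewrite -[k in p ^+ k]card_ord -prodr_const.
by rewrite -[k in (k * D)%N]card_ord; apply: msize_prod_le.
Qed.

Section Field.
Variable K : fieldType.

(** Transcendence degree, by counting: the t ^ d products of powers of the g i
with exponents below t have degree less than b, which is linear in t, hence
lie in the span of b ^ N monomials; for N < d and t large they are linearly
dependent. *)
Lemma alg_dependent N d (g : 'I_d -> {mpoly K[N]}) : (N < d)%N ->
  exists2 p : {mpoly K[d]}, p != 0 &
    forall y, p.@[fun i => (g i).@[y]] = 0.
Proof.
move=> N_lt_d.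
pose D := (\max_(i < d) msize (g i))%N.
(* b is at most (d * D).+1 * t, so b ^ N < t ^ N.+1 as soon as t > (d * D).+1 ^ N. *)
pose t := ((d * D).+1 ^ N).+1; pose b := (d * (t * D)).+1.
have g_le i : (msize (g i) <= D.+1)%N by apply: leqW (leq_bigmax _).
pose A := {ffun 'I_d -> 'I_t}; pose B := {ffun 'I_N -> 'I_b}.
pose monA (a : A) := [multinom (a i : nat) | i < d].
pose monB (c : B) := [multinom (c i : nat) | i < N].
pose G (a : A) := \prod_(i < d) g i ^+ a i.
have G_le a : (msize (G a) <= b)%N.
  rewrite /b -{1}(card_ord d); apply: msize_prod_le => i.
  apply: leq_trans (msize_exp_le (a i) (g_le i)) _.
  by rewrite ltnS leq_mul2r ltnW ?orbT.
have ltBA : (#|B| < #|A|)%N.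
  rewrite !card_ffun !card_ord.
  have b_le : (b <= (d * D).+1 * t)%N.
    by rewrite /b mulSn mulnA mulnAC -add1n leq_add2r.
  apply: (@leq_ltn_trans ((d * D).+1 ^ N * t ^ N)).
    rewrite -expnMn; have [N0|N_gt0] := posnP N; last by rewrite leq_exp2r.
    by rewrite N0 !expn0.
  apply: (@leq_trans (t ^ N.+1)); last by rewrite leq_pexp2l.
  by rewrite expnS ltn_pmul2r ?expn_gt0.
(* Row a of M lists the coefficients of G a; a vector in its left kernel is a
   linear relation between the products G a. *)
pose M : 'M[K]_(#|A|, #|B|) := \matrix_(i, j) (G (enum_val i))@_(monB (enum_val j)).
have ker_neq0 : kermx M != 0.
  rewrite -mxrank_eq0 mxrank_ker subn_eq0 -ltnNge.
  exact: leq_ltn_trans (rank_leq_col M) ltBA.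
have [u /sub_kermxP uM0 u_neq0] := rowV0Pn ker_neq0.
pose p : {mpoly K[d]} := \sum_i u 0 i *: 'X_[monA (enum_val i)].
exists p => [|y].
  have [i ui] : exists i, u 0 i != 0.
    apply/existsP; apply: contraNT u_neq0.
    rewrite negb_exists => /forallP u0; apply/eqP/rowP => i.
    by rewrite mxE; apply/eqP/negbNE/u0.
  apply: contraNneq ui => /(congr1 (mcoeff (monA (enum_val i)))).
  rewrite mcoeff0 raddf_sum (bigD1 i) //= mcoeffZ mcoeffX eqxx mulr1.
  rewrite big1 ?addr0 => [->//|j neq_ji]; rewrite mcoeffZ mcoeffX.
  case: eqP => [|_]; last by rewrite mulr0.
  move=> /mnmP eq_ji; case/eqP: neq_ji; apply: enum_val_inj.
  by apply/ffunP => k; apply: val_inj; have := eq_ji k; rewrite !mnmE.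
have -> : p.@[fun i => (g i).@[y]] = (\sum_i u 0 i *: G (enum_val i)).@[y].
  rewrite /p !raddf_sum; apply: eq_bigr => i _; rewrite /= !mevalZ mevalX.
  rewrite rmorph_prod; congr (_ * _); apply: eq_bigr => k _.
  by rewrite rmorphXn /= mnmE.
suff -> : \sum_i u 0 i *: G (enum_val i) = 0 by rewrite meval0.
apply/mpolyP => m; rewrite mcoeff0 raddf_sum /=.
(* Monomials of degree at least b occur in no G a; the others have all their
   exponents below b, hence are columns of M. *)
have [lt_m|le_m] := ltnP (mdeg m) b; last first.
  rewrite big1 // => i _; rewrite mcoeffZ memN_msupp_eq0 ?mulr0 //.
  exact: msize_mdeg_ge (leq_trans (G_le _) le_m).
have m_lt k : (m k < b)%N.
  by apply: leq_ltn_trans lt_m; rewrite mdegE (bigD1 k) //= leq_addr.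
pose c : B := [ffun k => Ordinal (m_lt k)].
have mE : m = monB c by apply/mnmP => k; rewrite mnmE ffunE.
have /rowP/(_ (enum_rank c)) := uM0; rewrite !mxE => uM0c; rewrite -[RHS]uM0c.
by apply: eq_bigr => i _; rewrite mcoeffZ mxE enum_rankK mE.
Qed.

End Field.

Section ClosedField.
Variable K : closedFieldType.

(** * Generic properties *)

Definition point_eval (I : finType) (x : {ffun I -> K}) (p : {mpoly K[#|I|]}) :=
  p.@[fun i => x (enum_val i)].

(** Every nonempty open set contains a nonempty basic one, so it is enough to look
at loci where a single nonzero polynomial h does not vanish.  Multiplying the
equations intersects such loci, and a product of nonzero polynomials is nonzero:
this is how the irreducibility of affine space enters. *)
Definition generically (I : finType) (P : {ffun I -> K} -> Prop) :=
  exists2 h : {mpoly K[#|I|]}, h != 0 & forall x, point_eval x h != 0 -> P x.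

Section Generically.
Variable I : finType.
Implicit Types P Q : {ffun I -> K} -> Prop.

Lemma genericallyW P Q :
  (forall x, P x -> Q x) -> generically P -> generically Q.
Proof. by move=> PQ [h h0 hP]; exists h => // x /hP/PQ. Qed.

Lemma generically_true P : (forall x, P x) -> generically P.
Proof. by exists 1; rewrite ?oner_neq0. Qed.

Lemma generically_and P Q :
  generically P -> generically Q -> generically (fun x => P x /\ Q x).
Proof.
move=> [h h0 hP] [k k0 kQ]; exists (h * k); first by rewrite mulf_neq0.
move=> x; rewrite /point_eval mevalM mulf_eq0 negb_or => /andP[hx kx].
by split; [apply: hP | apply: kQ].
Qed.

Lemma generically_forall (T : finType) (P : T -> {ffun I -> K} -> Prop) :
  (forall t, generically (P t)) -> generically (fun x => forall t, P t x).
Proof.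
move=> Pgen.
suff: generically (fun x => forall t, t \in enum T -> P t x).
  by apply: genericallyW => x Px t; apply: Px; rewrite mem_enum.
elim: (enum T) => [|t s IHs]; first exact: generically_true.
apply: genericallyW (generically_and (Pgen t) IHs) => x [Pt Ps] u.
by rewrite inE => /predU1P[->|/Ps].
Qed.

Lemma generically_ex P : generically P -> exists x, P x.
Proof.
move=> [h /mpoly_nonvanishing[v hv] hP]; exists [ffun i => v (enum_rank i)].
apply: hP; rewrite /point_eval (meval_eq (v2 := v)) // => i.
by rewrite ffunE enum_valK.
Qed.

Lemma open_generically (U : set {ffun I -> K}) :
  zariski_open U -> (U !=set0)%classic -> generically U.
Proof.
move=> [S ->] [x [p Sp px]]; exists p => [|y py]; last by exists p.
by apply: contraNneq px => ->; rewrite meval0.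
Qed.

Lemma generically_open P : generically P ->
  exists U : set {ffun I -> K},
    [/\ zariski_open U, (U !=set0)%classic & forall x, U x -> P x].
Proof.
move=> Pgen; have [h h0 hP] := Pgen.
exists (fun x => point_eval x h != 0); split=> //.
  exists [set h]%classic; apply/seteqP; split=> x /=; first by exists h.
  by case=> p ->.
by apply: (@generically_ex (fun x => point_eval x h != 0)); exists h.
Qed.

End Generically.

(** * Images of polynomial maps *)

Section Elimination.
Variable d : nat.

(** Valuations of formulas are sequences, padded with zeros; a point of affine
space is the valuation of the first d variables. *)
Let env (x : 'I_d -> K) : seq K := [seq x i | i <- enum 'I_d].

Lemma nth_env x k :
  (env x)`_k = if insub k is Some i then x i else 0.
Proof.
case: insubP => [i _ /= <-|]; last first.
  by rewrite -leqNgt => ?; rewrite nth_default // size_map size_enum_ord.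
by rewrite (nth_map i) ?size_enum_ord // nth_ord_enum.
Qed.

Lemma term_polynomial (t : GRing.term K) :
  GRing.rterm t -> exists p : {mpoly K[d]}, forall x, GRing.eval (env x) t = p.@[x].
Proof.
elim: t => //=.
- move=> k _; case: (insubP 'I_d k) => [i lt_k def_k|not_k].
    by exists 'X_i => x; rewrite nth_env -def_k valK mevalXU.
  by exists 0 => x; rewrite nth_env insubN // meval0.
- by move=> c _; exists c%:MP => x; rewrite mevalC.
- by move=> k _; exists k%:R => x; rewrite rmorph_nat.
- move=> t IHt u IHu /andP[/IHt[p pE] /IHu[q qE]].
  by exists (p + q) => x; rewrite mevalD pE qE.
- by move=> t IHt /IHt[p pE]; exists (- p) => x; rewrite mevalN pE.
- by move=> t IHt k /IHt[p pE]; exists (p *+ k) => x; rewrite mevalMn pE.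
- move=> t IHt u IHu /andP[/IHt[p pE] /IHu[q qE]].
  by exists (p * q) => x; rewrite mevalM pE qE.
- by move=> t IHt k /IHt[p pE]; exists (p ^+ k) => x; rewrite rmorphXn /= pE.
Qed.

(** An equation p = q between distinct polynomials is false wherever p - q does
not vanish; products of such open conditions take care of the connectives. *)
Lemma qf_locally_constant (f : GRing.formula K) :
  GRing.qf_form f && GRing.rformula f ->
  exists2 h : {mpoly K[d]}, h != 0 &
  exists b, forall x, h.@[x] != 0 -> GRing.qf_eval (env x) f = b.
Proof.
elim: f => //=.
- by move=> b _; exists 1; [exact: oner_neq0 | exists b].
- move=> t u /andP[/term_polynomial[p pE] /term_polynomial[q qE]].
  have [eq_pq|neq_pq] := eqVneq p q.
    exists 1; first exact: oner_neq0.
    by exists true => x _; rewrite pE qE eq_pq eqxx.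
  exists (p - q); first by rewrite subr_eq0.
  exists false => x; rewrite mevalB subr_eq0 pE qE => neq_x.
  exact: negbTE.
- move=> f IHf g IHg; rewrite andbACA => /andP[/IHf[h h0 [b hb]]].
  move=> /IHg[k k0 [c kc]]; exists (h * k); first exact: mulf_neq0.
  exists (b && c) => x; rewrite mevalM mulf_eq0 negb_or.
  by case/andP=> /hb -> /kc ->.
- move=> f IHf g IHg; rewrite andbACA => /andP[/IHf[h h0 [b hb]]].
  move=> /IHg[k k0 [c kc]]; exists (h * k); first exact: mulf_neq0.
  exists (b || c) => x; rewrite mevalM mulf_eq0 negb_or.
  by case/andP=> /hb -> /kc ->.
- move=> f IHf g IHg; rewrite andbACA => /andP[/IHf[h h0 [b hb]]].
  move=> /IHg[k k0 [c kc]]; exists (h * k); first exact: mulf_neq0.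
  exists (b ==> c) => x; rewrite mevalM mulf_eq0 negb_or.
  by case/andP=> /hb -> /kc ->.
- move=> f IHf /IHf[h h0 [b hb]]; exists h => //.
  by exists (~~ b) => x /hb ->.
Qed.

Lemma definable_locally_constant (f : GRing.formula K) : GRing.rformula f ->
  exists2 h : {mpoly K[d]}, h != 0 &
    (forall x, h.@[x] != 0 -> GRing.holds (env x) f) \/
    (forall x, h.@[x] != 0 -> ~ GRing.holds (env x) f).
Proof.
move=> f_ring; have closed := @solve_monicpoly K.
have wf := @ClosedFieldQE.wf_ex_elim K.
have ok := ClosedFieldQE.holds_ex_elim closed.
have [h h0 [b hb]] := qf_locally_constant (GRing.quantifier_elim_wf wf f_ring).
exists h => //; case: b hb => hb; [left|right] => x /hb.
  by move/(GRing.quantifier_elim_rformP wf ok _ f_ring).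
by move=> nf /(GRing.quantifier_elim_rformP wf ok _ f_ring); rewrite nf.
Qed.

(** The bound variables are numbered from the length of the valuation, so
quantifying over them amounts to extending the valuation on the right. *)
Lemma holds_foldr_exists (f : GRing.formula K) N (e : seq K) :
  GRing.holds e (foldr GRing.Exists f (iota (size e) N)) <->
  exists y : 'I_N -> K, GRing.holds (e ++ [seq y i | i <- enum 'I_N]) f.
Proof.
elim: N e => [|N IHN] e /=.
  rewrite enum_ord0 /= cats0; split=> [fe|[]//].
  by exists (fun i => 0).
have set_nth_rcons c (s : seq K) : set_nth 0 s (size s) c = rcons s c.
  by elim: s => //= a s ->.
split=> [[c]|[y fy]].
  rewrite set_nth_rcons -{1}(size_rcons e c) => /IHN[y fy].
  exists (fun i => if unlift ord0 i is Some j then y j else c).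
  rewrite enum_ordSl /= unlift_none -cat_rcons -map_comp.
  by rewrite (eq_map (g := y)) // => i /=; rewrite liftK.
exists (y ord0); rewrite set_nth_rcons -{1}(size_rcons e (y ord0)).
apply/IHN; exists (fun i => y (lift ord0 i)).
by rewrite cat_rcons; move: fy; rewrite enum_ordSl /= -map_comp.
Qed.

(** The first d variables are reserved for the target of a polynomial map, so a
polynomial on its source is written in the variables from d onwards. *)
Lemma polynomial_term N (p : {mpoly K[N]}) :
  exists2 t, GRing.rterm t &
    forall (x : 'I_d -> K) (y : 'I_N -> K),
      GRing.eval (env x ++ [seq y i | i <- enum 'I_N]) t = p.@[y].
Proof.
elim/mpolyind: p => [|c m p _ _ [t t_ring tE]].
  by exists (GRing.NatConst _ 0) => // x y; rewrite meval0.
pose u := foldr (fun i : 'I_N => GRing.Mul (GRing.Exp (GRing.Var K (d + i)) (m i)))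
                (GRing.NatConst K 1) (index_enum 'I_N).
exists (GRing.Add (GRing.Mul (GRing.Const c) u) t) => [|x y].
  by rewrite /= t_ring andbT /u; elim: (index_enum _).
rewrite /= tE mevalD mevalZ mevalX; congr (c * _ + _).
rewrite /u; elim: (index_enum _) => [|i s IHs] /=.
  by rewrite big_nil.
rewrite big_cons IHs nth_cat size_map size_enum_ord ltnNge leq_addr addKn /=.
by rewrite (nth_map i) ?size_enum_ord // nth_ord_enum.
Qed.

(** A weak form of Chevalley's theorem on constructible images, which is all that
genericity requires. *)
Lemma polynomial_image_locally_constant N (g : 'I_d -> {mpoly K[N]}) :
  let image x := exists y, forall i, (g i).@[y] = x i in
  exists2 h : {mpoly K[d]}, h != 0 &
    (forall x, h.@[x] != 0 -> image x) \/
    (forall x, h.@[x] != 0 -> ~ image x).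
Proof.
move=> image.
have termE i : exists t : GRing.term K, (GRing.rterm t /\
    forall (x : 'I_d -> K) (y : 'I_N -> K),
      GRing.eval (env x ++ [seq y j | j <- enum 'I_N]) t = (g i).@[y])%type.
  by have [t] := polynomial_term (g i); exists t.
have /choice[t tE] := termE.
pose eqs := foldr (fun i : 'I_d => GRing.And (GRing.Equal (t i) (GRing.Var K i)))
                  (GRing.Bool true) (enum 'I_d).
pose f := foldr GRing.Exists eqs (iota d N).
have eqsP x y : GRing.holds (env x ++ [seq y i | i <- enum 'I_N]) eqs <->
    forall i, (g i).@[y] = x i.
  transitivity (forall i, i \in enum 'I_d -> (g i).@[y] = x i); last first.
    by split=> gx i => [|_]; apply: gx; rewrite mem_enum.
  rewrite /eqs; elim: (enum 'I_d) => [|i s IHs] //=.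
  rewrite (tE i).2 nth_cat size_map size_enum_ord ltn_ord nth_env valK.
  split=> [[gi /IHs gs] j|gs]; first by rewrite inE => /predU1P[->|/gs].
  split; first by apply: gs; rewrite mem_head.
  by apply/IHs => j js; apply: gs; rewrite inE js orbT.
have fP x : GRing.holds (env x) f <-> image x.
  have := holds_foldr_exists eqs N (env x).
  rewrite size_map size_enum_ord => ->.
  by split=> -[y /eqsP]; exists y.
have f_ring : GRing.rformula f.
  rewrite /f; elim: (iota d N) => //=; rewrite /eqs.
  by elim: (enum _) => //= i s ->; rewrite (tE i).1.
have [h h0 hf] := definable_locally_constant f_ring.
by exists h => //; case: hf => hf; [left|right] => x /hf; rewrite fP.
Qed.

End Elimination.

Section PolynomialImage.
Variables I J : finType.
Variable g : I -> {mpoly K[#|J|]}.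

Definition poly_image (x : {ffun I -> K}) :=
  exists y : {ffun J -> K}, forall i, point_eval y (g i) = x i.

Let coord_image (x : 'I_#|I| -> K) :=
  exists y : 'I_#|J| -> K, forall i, (g (enum_val i)).@[y] = x i.

Lemma poly_imageE x : poly_image x <-> coord_image (fun i => x (enum_val i)).
Proof.
split=> [[y yx]|[y yx]].
  by exists (fun j => y (enum_val j)) => i; rewrite -yx.
exists [ffun j => y (enum_rank j)] => i.
rewrite -[i in RHS](enum_rankK i) -yx enum_rankK; apply: meval_eq => j.
by rewrite ffunE enum_valK.
Qed.

Lemma poly_image_generic :
  generically poly_image \/ generically (fun x => ~ poly_image x).
Proof.
have [h h0 gh] :=
  polynomial_image_locally_constant (fun i : 'I_#|I| => g (enum_val i)).
case: gh => gh.
  by left; exists h => // x /gh/poly_imageE.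
by right; exists h => // x /gh + /poly_imageE.
Qed.

Lemma poly_image_small : (#|J| < #|I|)%N -> generically (fun x => ~ poly_image x).
Proof.
move=> /(alg_dependent (fun i => g (enum_val i)))[p p0 pg].
exists p => // x + /poly_imageE[y yx].
by rewrite /point_eval -(pg y) (meval_eq _ yx) eqxx.
Qed.

End PolynomialImage.

(** * Charts for the completions of a given rank *)

Section Completion.
Variables (m n : nat) (E : {set 'I_m * 'I_n}).
Implicit Type M : partial_matrix K E.

Lemma completion_rank_le M A : completion M A -> (completion_rank M <= \rank A)%N.
Proof.
move=> MA; rewrite /completion_rank; case: ex_minnP => r _; apply.
by apply/asboolP; exists A.
Qed.

Lemma completion_rank_witness M :
  exists2 A, completion M A & \rank A = completion_rank M.
Proof. by rewrite /completion_rank; case: ex_minnP => r /asboolP. Qed.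

Lemma generic_completion_rankE r : is_generic_completion_rank K E r <->
  generically (fun M : partial_matrix K E => completion_rank M = r).
Proof.
split=> [[U [oU U0 Ur]]|/generically_open[U [oU U0 Ur]]].
  by apply: genericallyW (open_generically oU U0).
by exists U.
Qed.

Section Chart.
Variables (r : nat) (f : {ffun 'I_r -> 'I_m}).

(** The entries of the left factor outside the rows chosen by f, and all entries
of the right factor. *)
Definition chart_index : finType :=
  (({i : 'I_m | i \notin codom f} * 'I_r) + ('I_r * 'I_n))%type.

Lemma card_chart_index : injective f -> #|chart_index| = ((m - r) * r + r * n)%N.
Proof.
move=> f_inj; rewrite card_sum !card_prod card_sig !card_ord; congr (_ * _ + _)%N.
have := cardC (mem (codom f)); rewrite card_codom // !card_ord => card_m.
by rewrite -[X in _ = (X - r)%N]card_m addKn; apply: eq_card => i.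
Qed.

(** Row f k is the k-th row of the identity matrix, provided f is injective.
Allowing any ring of coefficients lets one definition serve both for the
polynomials of a chart and for their values. *)
Definition left_factor (S : pzRingType) (y : chart_index -> S) : 'M[S]_(m, r) :=
  \matrix_(i, k) if insub i is Some i' then y (inl (i', k)) else (f k == i)%:R.

Definition right_factor (S : pzRingType) (y : chart_index -> S) : 'M[S]_(r, n) :=
  \matrix_(k, j) y (inr (k, j)).

Definition chart (S : pzRingType) (y : chart_index -> S) : 'M[S]_(m, n) :=
  left_factor y *m right_factor y.

Lemma map_chart (S T : pzRingType) (phi : {rmorphism S -> T}) y :
  map_mx phi (chart y) = chart (phi \o y).
Proof.
rewrite /chart map_mxM; congr (_ *m _); apply/matrixP => i j; rewrite !mxE //.
by case: insub => // ; rewrite rmorph_nat.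
Qed.

Definition chart_poly (e : edge E) : {mpoly K[#|chart_index|]} :=
  chart (fun i => 'X_(enum_rank i)) (val e).1 (val e).2.

Lemma chart_polyE (y : {ffun chart_index -> K}) e :
  point_eval y (chart_poly e) = chart y (val e).1 (val e).2.
Proof.
rewrite /point_eval /chart_poly.
have := map_chart (meval (fun i => y (enum_val i))) (fun i => 'X_(enum_rank i)).
move/matrixP/(_ (val e).1 (val e).2); rewrite mxE => ->.
congr (chart _ _ _).
by apply: funext => i /=; rewrite mevalXU enum_rankK.
Qed.

(** Any factorization of A through its rows chosen by f can be corrected on those
rows, where the left factor may be replaced by the identity. *)
Lemma chart_surj (A : 'M[K]_(m, n)) : injective f ->
  (A <= rowsub f A)%MS -> exists y : {ffun chart_index -> K}, chart y = A.
Proof.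
move=> f_inj /submxP[B AB].
pose y : {ffun chart_index -> K} := [ffun u : chart_index =>
  match u with inl (i, k) => B (val i) k | inr (k, j) => A (f k) j end].
exists y; apply/matrixP => i j; rewrite mxE.
have right k : right_factor y k j = A (f k) j by rewrite mxE ffunE.
under eq_bigr do rewrite right mxE.
case: insubP => [i' _ <-|].
  rewrite [in RHS]AB mxE; apply: eq_bigr => k _.
  by rewrite ffunE mxE.
rewrite negbK => /codomP[k ->]; rewrite (bigD1 k) //= eqxx mul1r.
rewrite big1 ?addr0 // => l neq_lk.
by rewrite (inj_eq f_inj) (negbTE neq_lk) mul0r.
Qed.

End Chart.

(** Any matrix has independent rows that span its row space; apply this to a
completion of smallest rank. *)
Lemma completion_rank_chart M : exists f : {ffun 'I_(completion_rank M) -> 'I_m},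
  injective f /\ poly_image (chart_poly f) M.
Proof.
have [A MA <-] := completion_rank_witness M.
pose f := maxrankfun A; have f_inj : injective f by exact: maxrankfun_inj.
exists f; split=> //.
have [|y yA] := @chart_surj _ f A f_inj; first by rewrite eq_maxrowsub.
by exists y => e; rewrite chart_polyE yA.
Qed.

Lemma chart_completion_rank M r (f : {ffun 'I_r -> 'I_m}) :
  poly_image (chart_poly f) M -> (completion_rank M <= r)%N.
Proof.
case=> y yM; have MA : completion M (chart y).
  by move=> e; rewrite -chart_polyE.
apply: leq_trans (completion_rank_le MA) _.
exact: leq_trans (mxrankM_maxl _ _) (rank_leq_col _).
Qed.

(** * The generic completion rank *)

(** The completion rank is the least s such that some chart of size s contains the
partial matrix, and for each s <= m this condition is generically constant. *)
Lemma generic_completion_rank_exists : exists r, is_generic_completion_rank K E r.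
Proof.
pose C M r := exists f : {ffun 'I_r -> 'I_m}, poly_image (chart_poly f) M.
pose b r := `[< generically (fun M => C M r) >].
have bC : generically (fun M => forall r : 'I_m.+1, C M r <-> b r).
  apply: generically_forall => r.
  have [Cr|nCr] := pselect (generically (fun M => C M r)).
    apply: genericallyW (Cr) => M CMr; split=> // _; exact/asboolP.
  have missed (f : {ffun 'I_r -> 'I_m}) :
      generically (fun M => ~ poly_image (chart_poly f) M).
    have [hit|//] := poly_image_generic (chart_poly f).
    by case: nCr; apply: genericallyW hit => M fM; exists f.
  apply: genericallyW (generically_forall missed) => M fM.
  by split=> [[f /fM]//|/asboolP].
have rankE M : (forall r : 'I_m.+1, C M r <-> b r) -> exists2 r : 'I_m.+1, b r &
   completion_rank M = r /\ forall s : 'I_m.+1, b s -> (r <= s)%N.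
  move=> Mb; have le_m : (completion_rank M < m.+1)%N.
    have [A _ <-] := completion_rank_witness M; exact: rank_leq_row.
  exists (Ordinal le_m); last first.
    by split=> // s /Mb[f /chart_completion_rank].
  by apply/Mb; have [f [_ fM]] := completion_rank_chart M; exists f.
have [M0 /rankE[r br [_ r_min]]] := generically_ex bC.
exists r; apply/generic_completion_rankE; apply: genericallyW bC => M.
case/rankE=> s bs [-> s_min]; apply/eqP.
by rewrite eqn_leq r_min // s_min.
Qed.

Lemma generic_completion_rankP :
  generically (fun M : partial_matrix K E =>
    completion_rank M = generic_completion_rank K E).
Proof.
apply/generic_completion_rankE; have [r r_gen] := generic_completion_rank_exists.
by rewrite /generic_completion_rank; case: xgetP => [s -> //|/(_ r)].
Qed.

(** Generically the partial matrix lies in a chart of size r, so one of these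
charts is not contained in a hypersurface and has at least #|E| parameters. *)
Lemma generic_completion_rank_params (r := generic_completion_rank K E) :
  (r <= m)%N /\ (#|E| <= (m - r) * r + r * n)%N.
Proof.
split.
  have [M Mr] := generically_ex generic_completion_rankP; rewrite /r -Mr.
  by have [A _ <-] := completion_rank_witness M; exact: rank_leq_row.
rewrite leqNgt; apply/negP => lt_E.
have missed (f : {ffun 'I_r -> 'I_m}) :
    generically (fun M => injective f -> ~ poly_image (@chart_poly r f) M).
  have [f_inj|nf] := pselect (injective f); last exact: generically_true.
  apply: genericallyW (_ : generically (fun M => ~ poly_image (@chart_poly r f) M)).
    by [].
  apply: poly_image_small; rewrite card_chart_index //.
  by apply: leq_trans lt_E _; rewrite card_sig; apply/eq_leq/eq_card.
have [M [Mr]] := generically_ex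
  (generically_and generic_completion_rankP (generically_forall missed)).
have := completion_rank_chart M; rewrite Mr => -[f [f_inj fM]].
by move=> /(_ f f_inj).
Qed.

Lemma generic_completion_rank_ge_biclique (r : nat) :
  has_complete_bipartite E r -> (r <= generic_completion_rank K E)%N.
Proof.
move=> [A [B [Ar Br /fintype.subsetP ABE]]].
have [a a_inj aA] : exists2 a : 'I_r -> 'I_m, injective a & forall k, a k \in A.
  rewrite -Ar; exists enum_val; [exact: enum_val_inj | exact: enum_valP].
have [b b_inj bB] : exists2 b : 'I_r -> 'I_n, injective b & forall k, b k \in B.
  rewrite -Br; exists enum_val; [exact: enum_val_inj | exact: enum_valP].
have abE k l : (a k, b l) \in E by rewrite ABE // inE aA bB.
pose e k l : edge E := exist _ (a k, b l) (abE k l).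
pose sub M : 'M[K]_r := \matrix_(k, l) M (e k l).
pose h : {mpoly K[#|{: edge E}|]} := \det (\matrix_(k < r, l < r) 'X_(enum_rank (e k l))).
have hE M : point_eval M h = \det (sub M).
  rewrite /point_eval -det_map_mx; congr (\det _); apply/matrixP => k l.
  by rewrite !mxE /= mevalXU enum_rankK.
(* The determinant of the specified submatrix is a nonzero polynomial: it takes
   the value 1 at the partial matrix whose submatrix is the identity. *)
have sub_generic : generically (fun M : partial_matrix K E => \det (sub M) != 0).
  exists h => [|M]; last by rewrite hE.
  pose M0 : partial_matrix K E := [ffun e => [exists k, val e == (a k, b k)]%:R].
  have : point_eval M0 h != 0.
    rewrite hE (_ : sub M0 = 1%:M) ?det1 ?oner_neq0 //.
    apply/matrixP => k l; rewrite !mxE ffunE /=; congr (nat_of_bool _)%:R.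
    apply/existsP/eqP => [[i /eqP[/a_inj-> /b_inj->]] //|->].
    by exists l; rewrite eqxx.
  by apply: contraNneq => ->; rewrite /point_eval meval0.
have [M [<- det_neq0]] :=
  generically_ex (generically_and generic_completion_rankP sub_generic).
have [C MC <-] := completion_rank_witness M.
have subE : sub M = mxsub a b C.
  by apply/matrixP => k l; rewrite !mxE -MC.
have <- : \rank (sub M) = r by apply: mxrank_unit; rewrite unitmxE unitfE.
rewrite subE (_ : mxsub a b C = rowsub a 1%:M *m (C *m colsub b 1%:M)); last first.
  by rewrite mulmx_colsub mulmx1 mul_rowsub_mx mul1mx; apply/matrixP => k l; rewrite !mxE.
by apply: leq_trans (mxrankM_maxr _ _) (mxrankM_maxl _ _).
Qed.

End Completion.
End ClosedField.

Theorem proposition2p5 (R : realType) (m n : nat) (E : {set 'I_m * 'I_n}) :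
  (forall k : nat,
     smallest_nat
       (fun l => l%:Z * (m%:Z + n%:Z) - l%:Z ^+ 2 >= #|E|%:Z) k ->
     (k <= generic_completion_rank R[i] E)%N) /\
  (forall r : nat,
     largest_nat (has_complete_bipartite E) r ->
     (r <= generic_completion_rank R[i] E)%N).
Proof.
split=> [k [_ k_min]|r [Er _]]; last exact: generic_completion_rank_ge_biclique.
have [r_le E_le] := generic_completion_rank_params R[i] E.
(* This rewriting of the parameter count relies on the generic rank being at most
   m, the subtraction m - r being truncated. *)
apply: k_min; set r := generic_completion_rank _ _ in r_le E_le *.
suff -> : r%:Z * (m%:Z + n%:Z) - r%:Z ^+ 2 = ((m - r) * r + r * n)%N :> int.
  by rewrite lez_nat.
by rewrite PoszD !PoszM -subzn // mulrBl mulrDr expr2 [_ * m%:Z]mulrC addrAC.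
Qed.
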